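(* Let $\alpha,\beta>-1$, let $w_J(x)=(1-x)^{\alpha}(1+x)^{\beta}w_0(x)$, $x\in[-1,1]$, be a Jacobi-type weight function as in the context, and let $v_J(x):=-\ln w_J(x)$. Denote the Jacobi-type weight function with jump discontinuities by $$\widetilde w(x;\vec t\,):=w_J(x)\left(\omega_0+\sum_{k=1}^{m}\omega_k\theta(x-t_k)\right),$$ where $w_J$ is independent of $\vec t=(t_1,\dots,t_m)$ with $-1\le t_1<\cdots<t_m\le1$, $\sum_{k=0}^{\ell}\omega_k\ge0$ for $0\le\ell\le m$, and $\theta(x)$ is the Heaviside step function, which is $1$ for $x>0$ and $0$ otherwise. The associated monic orthogonal polynomials $P_n(x)=P_n(x;\vec t\,)$, with $h_n$, $\mathbf p(n)$, $\beta_n$ as in the context, satisfy the ladder operators $$P_n'(z)=-B_n(z)P_n(z)+\beta_nA_n(z)P_{n-1}(z),$$ $$P_{n-1}'(z)=\bigl(B_n(z)+v_J'(z)\bigr)P_{n-1}(z)-A_{n-1}(z)P_n(z)$$ for $n\ge0$, with $A_{-1}(z)=B_0(z):=0$ and $$\begin{aligned}A_n(z)=&\frac{1}{1-z^2}\left[\frac1{h_n}\int_{-1}^{1}\frac{(1-z^2)v_J'(z)-(1-x^2)v_J'(x)}{z-x}P_n^2(x;\vec t\,)\widetilde w(x;\vec t\,)\,dx+2n+1+\sum_{k=1}^{m}R^{\star}_{n,k}(z+t_k)\right]\\&+\sum_{k=1}^{m}\frac{R^{\star}_{n,k}}{z-t_k},\qquad n\ge0,\end{aligned}$$ $$\begin{aligned}B_n(z)=&\frac{1}{1-z^2}\left[\frac1{h_{n-1}}\int_{-1}^{1}\frac{(1-z^2)v_J'(z)-(1-x^2)v_J'(x)}{z-x}P_n(x;\vec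 t\,)P_{n-1}(x;\vec t\,)\widetilde w(x;\vec t\,)\,dx+nz-\mathbf p(n)+\sum_{k=1}^{m}r^{\star}_{n,k}(z+t_k)\right]\\&+\sum_{k=1}^{m}\frac{r^{\star}_{n,k}}{z-t_k},\qquad n\ge1,\end{aligned}$$ where, for $k=1,\dots,m$, $$R^{\star}_{n,k}(\vec t\,):=\frac{\omega_kw_J(t_k)P_n^2(t_k;\vec t\,)}{h_n},\qquad r^{\star}_{n,k}(\vec t\,):=\frac{\omega_kw_J(t_k)P_n(t_k;\vec t\,)P_{n-1}(t_k;\vec t\,)}{h_{n-1}}.$$
   Context: Weight: $w_0(x)$ is a continuously differentiable function, $w_0(x)>0$, and $w_0(x)$ is bounded at the endpoints $\pm1$ of $[-1,1]$; all moments $\int_{-1}^1x^jw_J(x)\,dx$, $j=0,1,\dots$, are finite. Polynomials: $P_0(x):=1$, $P_{-1}(x):=0$, and $P_j(x)=x^j+\mathbf p(j)x^{j-1}+\cdots$, $j\ge1$, is the monic polynomial of degree $j$ such that $\int_{-1}^1P_i(x)P_j(x)\widetilde w(x;\vec t\,)\,dx=h_j\delta_{ij}$ for $i,j\ge0$ ($\delta_{ij}$ is the Kronecker delta); thus $\mathbf p(j)$ is the coefficient of $x^{j-1}$ in $P_j$, and $\mathbf p(0):=0$. $\beta_j=h_j/h_{j-1}$ for $j\ge1$ (distinct from the exponent $\beta$); the term containing $\beta_0$ is multiplied by $P_{-1}=0$. A prime denotes differentiation.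
   Formalization: Each ladder identity is asserted for real z in (-1,1), z ≠ t_k, whenever the integrals in the A_n(z), A_{n-1}(z), B_n(z) occurring in it converge absolutely; for w_0 merely continuously differentiable they may diverge, leaving the formulas undefined. *)

(* Defs.v *)
From HB Require Import structures.
From mathcomp Require Import all_boot all_order all_algebra.
From mathcomp Require Import all_classical all_reals all_analysis.

Set Implicit Arguments.
Unset Strict Implicit.
Unset Printing Implicit Defensive.

Import Order.TTheory GRing.Theory Num.Theory.
Import numFieldNormedType.Exports.

Local Open Scope classical_set_scope.
Local Open Scope ring_scope.

(* Index conventions: the jump locations are t 1, ..., t m and the jump
   coefficients are om 0, ..., om m; other values of the functions
   t, om : nat -> R are never used. *)

(* [x `^ al] is a total function, with 0 `^ al = 0 for al < 0; hence the value
   at x = 1 (resp. -1) is 0 where the weight is infinite. *)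
Definition jacobi_weight {R : realType} (al be : R) (w0 : R -> R) (x : R) : R :=
  (1 - x) `^ al * (1 + x) `^ be * w0 x.

(* Continuous differentiability is required on ]-1, 1[ only; at the endpoints
   w0 is merely bounded. *)
Record smooth_factor {R : realType} (w0 : R -> R) : Prop := SmoothFactor {
  smooth_factor_derivable : {in `]-1, 1[, forall x, derivable w0 x 1};
  smooth_factor_derivative_continuous : {in `]-1, 1[, continuous (derive1 w0)};
  smooth_factor_gt0 : {in `[-1, 1], forall x, 0 < w0 x};
  smooth_factor_bounded_left : bounded_near w0 (-1)^'+;
  smooth_factor_bounded_right : bounded_near w0 1^'-
}.

Definition finite_moments {R : realType} (w : R -> R) : Prop :=
  forall j : nat, (@lebesgue_measure R).-integrable `[-1, 1]
    (fun x => (x ^+ j * w x)%:E).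

Definition heaviside {R : realType} (x : R) : R := if 0 < x then 1 else 0.

Definition jump_weight {R : realType} (w : R -> R) (m : nat) (om t : nat -> R)
    (x : R) : R :=
  w x * (om 0%N + \sum_(1 <= k < m.+1) om k * heaviside (x - t k)).

(* The condition h j != 0 is part of the existence of the orthogonal
   polynomials: it fails only if the weight vanishes almost everywhere. *)
Record monic_orthogonal {R : realType} (wt : R -> R) (P : nat -> {poly R})
    (h : nat -> R) : Prop := MonicOrthogonal {
  monic_orthogonal_monic : forall j, P j \is monic;
  monic_orthogonal_size : forall j, size (P j) = j.+1;
  monic_orthogonal_int : forall i j,
    \int[lebesgue_measure]_(x in `[-1, 1]) ((P i).[x] * (P j).[x] * wt x) =
      if i == j then h j else 0;
  monic_orthogonal_neq0 : forall j, h j != 0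
}.

(* The term of index n - 1 of a sequence starting at index -1 with a. *)
Definition pred_term {T : Type} (a : T) (f : nat -> T) (n : nat) : T :=
  if n is n'.+1 then f n' else a.

Definition subleading {R : realType} (P : nat -> {poly R}) (j : nat) : R :=
  if j is j'.+1 then (P j)`_j' else 0.

(* The value at j = 0 is a dummy: it only ever multiplies P_{-1} = 0. *)
Definition rec_beta {R : realType} (h : nat -> R) (j : nat) : R :=
  if j is j'.+1 then h j / h j' else 0.

Definition potential {R : realType} (w : R -> R) (x : R) : R := - ln (w x).

Definition potential_quotient {R : realType} (w : R -> R) (z x : R) : R :=
  ((1 - z ^+ 2) * derive1 (potential w) z
     - (1 - x ^+ 2) * derive1 (potential w) x) / (z - x).

Definition ladder_R {R : realType} (w : R -> R) (om t : nat -> R)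
    (P : nat -> {poly R}) (h : nat -> R) (n k : nat) : R :=
  om k * w (t k) * (P n).[t k] ^+ 2 / h n.

Definition ladder_r {R : realType} (w : R -> R) (om t : nat -> R)
    (P : nat -> {poly R}) (h : nat -> R) (n k : nat) : R :=
  om k * w (t k) * (P n).[t k] * (P n.-1).[t k] / h n.-1.

Definition integrand_A {R : realType} (w : R -> R) (m : nat) (om t : nat -> R)
    (P : nat -> {poly R}) (n : nat) (z x : R) : R :=
  potential_quotient w z x * (P n).[x] ^+ 2 * jump_weight w m om t x.

Definition integrand_B {R : realType} (w : R -> R) (m : nat) (om t : nat -> R)
    (P : nat -> {poly R}) (n : nat) (z x : R) : R :=
  potential_quotient w z x * (P n).[x] * (P n.-1).[x] * jump_weight w m om t x.

Definition ladder_A {R : realType} (w : R -> R) (m : nat) (om t : nat -> R)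
    (P : nat -> {poly R}) (h : nat -> R) (n : nat) (z : R) : R :=
  (1 - z ^+ 2)^-1 *
    ((h n)^-1 * \int[lebesgue_measure]_(x in `[-1, 1])
                  integrand_A w m om t P n z x
     + (2 * n + 1)%:R
     + \sum_(1 <= k < m.+1) ladder_R w om t P h n k * (z + t k))
  + \sum_(1 <= k < m.+1) ladder_R w om t P h n k / (z - t k).

Definition ladder_B {R : realType} (w : R -> R) (m : nat) (om t : nat -> R)
    (P : nat -> {poly R}) (h : nat -> R) (n : nat) (z : R) : R :=
  if n is n'.+1 then
    (1 - z ^+ 2)^-1 *
      ((h n')^-1 * \int[lebesgue_measure]_(x in `[-1, 1])
                     integrand_B w m om t P n z x
       + n%:R * z - subleading P n
       + \sum_(1 <= k < m.+1) ladder_r w om t P h n k * (z + t k))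
    + \sum_(1 <= k < m.+1) ladder_r w om t P h n k / (z - t k)
  else 0.

(* For a merely continuously differentiable w0 the quotient above need not be
   integrable near x = z; the next two predicates say that the integrals in
   A_n(z) and B_n(z) exist, without which the formulas have no meaning. *)
Definition ladder_A_exists {R : realType} (w : R -> R) (m : nat)
    (om t : nat -> R) (P : nat -> {poly R}) (z : R) (n : nat) : Prop :=
  (@lebesgue_measure R).-integrable `[-1, 1]
    (fun x => (integrand_A w m om t P n z x)%:E).

Definition ladder_B_exists {R : realType} (w : R -> R) (m : nat)
    (om t : nat -> R) (P : nat -> {poly R}) (z : R) (n : nat) : Prop :=
  (0 < n)%N ->
  (@lebesgue_measure R).-integrable `[-1, 1]
    (fun x => (integrand_B w m om t P n z x)%:E).

(* Main.v *)
(* Let K(x, z) = (P_n(x) P_(n-1)(z) - P_(n-1)(x) P_n(z)) / (h_(n-1) (x - z)) be the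
   Christoffel-Darboux kernel and D(x) = (x - z) K(x, z) its numerator. For Q = P_n
   or Q = P_(n-1), the reproducing property gives Q'(z) = int Q' K w~, and writing
   1 - z^2 = (1 - x^2) + (x + z)(x - z) leads to
     (1 - z^2) Q'(z) = int ((1 - x^2) Q K)' w~ + int ((x + z) Q D)' w~.
   The last integral is read off the leading coefficients of P_n and P_(n-1). The
   first one is integrated by parts: the endpoints do not contribute because
   (1 - x^2) w_J vanishes there, each t_k contributes a jump, and the remaining term
   int (1 - x^2) v_J' Q K w~ equals
   (1 - z^2) v_J'(z) int Q K w~ + int q(z, x) Q D w~, q being the difference quotient
   in A_n and B_n. Expanding D separates the coefficients of P_(n-1)(z) and P_n(z),
   which are multiples of A and B because
   (1 - t^2)/(z - t) = (z + t) + (1 - z^2)/(z - t). *)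
Require Import Defs.
From HB Require Import structures.
From mathcomp Require Import all_boot all_order all_algebra ring lra.
From mathcomp Require Import all_classical all_reals all_analysis.
From mathcomp Require Import measurable_realfun.
Import Order.TTheory GRing.Theory Num.Theory.
Import numFieldNormedType.Exports.
Local Open Scope classical_set_scope.
Local Open Scope ring_scope.

Set Implicit Arguments.
Unset Strict Implicit.
Unset Printing Implicit Defensive.

(** * Orthogonal polynomials and the Christoffel-Darboux kernel *)

(** Orthogonality is stated for an abstract linear functional, so that the algebra of the kernel
    stays free of integrals and integrability. [L] is later integration against the jump weight. *)
Record orthogonal_for {R : numFieldType} (L : {scalar {poly R}})
    (P : nat -> {poly R}) (h : nat -> R) : Prop := OrthogonalFor {
  orthogonal_for_monic : forall j, P j \is monic;
  orthogonal_for_size : forall j, size (P j) = j.+1;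
  orthogonal_forM : forall i j, L (P i * P j) = if i == j then h j else 0;
  orthogonal_for_neq0 : forall j, h j != 0
}.

Lemma size_sub_lead {R : nzRingType} (p q : {poly R}) (n : nat) :
  q \is monic -> size q = n.+1 -> (size p <= n.+1)%N ->
  (size (p - p`_n *: q)%R <= n)%N.
Proof.
move=> /monicP; rewrite /lead_coef => qm sq sp.
apply/leq_sizeP => j; rewrite leq_eqVlt => /predU1P[<-|nj].
  by rewrite coefB coefZ; move: qm; rewrite sq /= => ->; rewrite mulr1 subrr.
rewrite coefB coefZ nth_default ?(leq_trans sp)//.
by rewrite [q`_j]nth_default ?sq// mulr0 subr0.
Qed.

Lemma size_deriv_leq {R : nzRingType} (p : {poly R}) (n : nat) :
  (size p <= n.+1)%N -> (size p^`() <= n)%N.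
Proof.
move=> sp; apply/leq_sizeP => j nj.
by rewrite coef_deriv nth_default ?mul0rn// (leq_trans sp).
Qed.

Lemma size_XaddC_mul_leq {R : nzRingType} (p : {poly R}) (c : R) (n : nat) :
  (size p <= n)%N -> (size (('X + c%:P) * p)%R <= n.+1)%N.
Proof.
move=> sp; rewrite (leq_trans (size_polyMleq _ _))// size_XaddC /=.
by rewrite ltnS.
Qed.

Lemma orthogonal_lt_size {R : numFieldType} (L : {scalar {poly R}}) P h
    (p : {poly R}) (n : nat) :
  orthogonal_for L P h -> (size p <= n)%N -> L (p * P n) = 0.
Proof.
case=> Pm Ps PP _.
(* Induction on the degree bound [k] with [n] fixed: the top term of [q] is a multiple of some [P k]
   with [k < n], which [L] sends to 0 against [P n]. *)
suff ortho k (q : {poly R}) :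
    (k <= n)%N -> (size q <= k)%N -> L (q * P n) = 0 by exact: ortho.
elim: k q {p} => [|k IH] p kn sp.
  by move: sp; rewrite size_poly_leq0 => /eqP ->; rewrite mul0r linear0.
have := IH _ (ltnW kn) (size_sub_lead (Pm k) (Ps k) sp).
rewrite mulrBl -scalerAl linearB linearZ /= PP ltn_eqF// mulr0 subr0; exact.
Qed.

Lemma orthogonal_eq_size {R : numFieldType} (L : {scalar {poly R}}) P h
    (p : {poly R}) (n : nat) :
  orthogonal_for L P h -> (size p <= n.+1)%N -> L (p * P n) = p`_n * h n.
Proof.
move=> Lo sp; have := Lo => -[Pm Ps PP _].
rewrite -[p in LHS](subrK (p`_n *: P n)) mulrDl linearD /=.
rewrite (orthogonal_lt_size Lo) ?size_sub_lead// add0r.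
by rewrite -scalerAl linearZ /= PP eqxx.
Qed.

(** Removing the multiple of [P n.+1] from [p] changes its coefficient of degree [n] by a multiple
    of the subleading coefficient of [P n.+1]. This is how p(n) enters the formula for B_n. *)
Lemma orthogonal_succ_size {R : numFieldType} (L : {scalar {poly R}}) P h
    (p : {poly R}) (n : nat) :
  orthogonal_for L P h -> (size p <= n.+2)%N ->
  L (p * P n) = (p`_n - p`_n.+1 * (P n.+1)`_n) * h n.
Proof.
move=> Lo sp; have := Lo => -[Pm Ps PP _].
rewrite -[p in LHS](subrK (p`_n.+1 *: P n.+1)) mulrDl linearD /=.
rewrite (orthogonal_eq_size Lo) ?size_sub_lead//.
rewrite -[in X in _ + X]scalerAl [L (_ *: _)]linearZ /= PP gtn_eqF//.
by rewrite mulr0 addr0 coefB coefZ.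
Qed.

(* By the Christoffel-Darboux formula, [cd_kernel P h n z] is the reproducing
   kernel of the polynomials of degree at most n, with second argument z. *)
Definition cd_numer {R : numFieldType} (P : nat -> {poly R}) (h : nat -> R)
    (n : nat) (z : R) : {poly R} :=
  (h n)^-1 *: ((P n).[z] *: P n.+1 - (P n.+1).[z] *: P n).

Definition cd_kernel {R : numFieldType} (P : nat -> {poly R}) (h : nat -> R)
    (n : nat) (z : R) : {poly R} :=
  cd_numer P h n z %/ ('X - z%:P).

Lemma divp_XsubCK {R : fieldType} (p : {poly R}) (z : R) :
  p.[z] = 0 -> (p %/ ('X - z%:P)) * ('X - z%:P) = p.
Proof. by move=> pz; apply: divpK; rewrite dvdp_XsubCl; apply/rootP. Qed.

Lemma size_divp_XsubC {R : fieldType} (p : {poly R}) (z : R) (n : nat) :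
  (size p <= n.+1)%N -> (size (p %/ ('X - z%:P))%R <= n)%N.
Proof.
by move=> sp; rewrite size_divp ?polyXsubC_eq0// size_XsubC leq_subLR.
Qed.

Lemma coef_divp_XsubC {R : fieldType} (p : {poly R}) (z : R) (n : nat) :
  (size p <= n.+2)%N -> p.[z] = 0 -> (p %/ ('X - z%:P))`_n = p`_n.+1.
Proof.
move=> sp pz; rewrite -[in RHS](divp_XsubCK pz) mulrBr coefB coefMX coefMC /=.
by rewrite [X in _ - X * _]nth_default ?mul0r ?subr0// size_divp_XsubC.
Qed.

Lemma cd_kernelE {R : numFieldType} (P : nat -> {poly R}) (h : nat -> R) n z :
  cd_kernel P h n z * ('X - z%:P) = cd_numer P h n z.
Proof.
apply: divp_XsubCK; rewrite /cd_numer !hornerE.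
by rewrite [X in _ * (X - _)]mulrC addrN mulr0.
Qed.

Lemma size_cd_numer {R : numFieldType} (L : {scalar {poly R}}) P h n z :
  orthogonal_for L P h -> (size (cd_numer P h n z) <= n.+2)%N.
Proof.
case=> _ Ps _ _; apply: leq_trans (size_scale_leq _ _) _.
apply: leq_trans (size_polyD _ _) _; rewrite geq_max.
rewrite (leq_trans (size_scale_leq _ _)) ?Ps//=.
by rewrite size_polyN ?(leq_trans (size_scale_leq _ _)) ?Ps.
Qed.

Lemma size_cd_kernel {R : numFieldType} (L : {scalar {poly R}}) P h n z :
  orthogonal_for L P h -> (size (cd_kernel P h n z) <= n.+1)%N.
Proof. by move=> Lo; rewrite size_divp_XsubC// (size_cd_numer _ _ Lo). Qed.

(* Writing p = p(z) + (X - z) q turns L (p K) into p(z) L K + L (q D), where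
   D = (X - z) K is orthogonal to degrees below n. That L K = 1 follows from the
   cases p = P_n and p = P_(n+1), which do not vanish simultaneously at z. *)
Lemma cd_kernel_reproducing {R : numFieldType} (L : {scalar {poly R}}) P h
    (p : {poly R}) (n : nat) (z : R) :
  orthogonal_for L P h -> (size p <= n.+1)%N ->
  L (p * cd_kernel P h n z) = p.[z].
Proof.
move=> Lo sp; have := Lo => -[Pm Ps PP hn0].
set K := cd_kernel _ _ _ _.
have Kz : K * ('X - z%:P) = cd_numer P h n z by exact: cd_kernelE.
have sK : (size K <= n.+1)%N by exact: size_cd_kernel Lo.
pose quo (q : {poly R}) := (q - q.[z]%:P) %/ ('X - z%:P).
have quoE q : q = quo q * ('X - z%:P) + q.[z]%:P.
  by rewrite divp_XsubCK ?subrK// !hornerE subrr.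
have size_qz (q : {poly R}) m :
    (size q <= m.+1)%N -> (size (q - q.[z]%:P)%R <= m.+1)%N.
  move=> sq; rewrite (leq_trans (size_polyD _ _))// geq_max sq size_polyN.
  by rewrite (leq_trans (size_polyC_leq1 _)).
have LqK q : L (q * K) = (h n)^-1 * ((P n).[z] * L (quo q * P n.+1)
    - (P n.+1).[z] * L (quo q * P n)) + q.[z] * L K.
  rewrite {1}(quoE q) mulrDl linearD /= mul_polyC linearZ /=; congr (_ + _).
  rewrite -mulrA [('X - _) * K]mulrC Kz /cd_numer -scalerAr linearZ /= mulrBr.
  by rewrite linearB -!scalerAr !linearZ.
have quo_small (q : {poly R}) : (size q <= n.+1)%N -> L (q * K) = q.[z] * L K.
  move=> sq; have squo : (size (quo q) <= n)%N.
    by apply: size_divp_XsubC; exact: size_qz.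
  rewrite LqK !(orthogonal_lt_size Lo) ?(leq_trans squo)//.
  by rewrite !mulr0 subr0 mulr0 add0r.
rewrite quo_small//; suff -> : L K = 1 by rewrite mulr1.
(* The coefficient of degree [n] of [K] is the leading one of its numerator, P_n(z) / h_n. *)
have K_n : L (P n * K) = (P n).[z].
  rewrite mulrC (orthogonal_eq_size Lo sK) coef_divp_XsubC ?(size_cd_numer _ _ Lo)//.
    rewrite /cd_numer !(coefZ, coefB) [(P n)`_n.+1]nth_default ?Ps//.
    have /monicP := Pm n.+1; rewrite /lead_coef Ps /= => ->.
    by rewrite mulr0 subr0 mulr1 mulrC mulrA divff// mul1r.
  by rewrite -Kz !hornerE subrr mulr0.
(* L (K P_(n+1)) is computed twice: it is 0 by degree, while [LqK] gives P_(n+1)(z) (L K - 1), the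
   quotient of P_(n+1) being monic of degree n. *)
have K_Sn : (P n.+1).[z] * (L K - 1) = 0.
  have : L (K * P n.+1) = 0 by apply: (orthogonal_lt_size Lo).
  have s1 : (size (P n.+1) <= n.+2)%N by rewrite Ps.
  have squo : (size (quo (P n.+1)) <= n.+1)%N.
    by apply: size_divp_XsubC; exact: size_qz.
  rewrite mulrC LqK (orthogonal_lt_size Lo squo) (orthogonal_eq_size Lo squo).
  rewrite coef_divp_XsubC ?size_qz//; last by rewrite !hornerE subrr.
  have /monicP := Pm n.+1; rewrite /lead_coef Ps /= => P1.
  rewrite coefB coefC P1 /= subr0 mul1r mulr0 sub0r => E.
  rewrite mulrBr mulr1 -{}E; have := hn0 n; move: (h n) => x x0; field.
  by rewrite x0.
have [Pz0|Pz0] := eqVneq (P n).[z] 0; last first.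
  by apply: (mulfI Pz0); rewrite mulr1 -quo_small ?Ps.
have [PSz0|PSz0] := eqVneq (P n.+1).[z] 0; last first.
  by apply/eqP; move/eqP: K_Sn; rewrite mulf_eq0 (negPf PSz0) subr_eq0.
(* A common root z is impossible: if P_(n+1) = (X - z) U and P_n = (X - z) V, then U P_n = V
   P_(n+1), but [L] maps the left side to h_n and the right side to 0. *)
have := divp_XsubCK Pz0; have := divp_XsubCK PSz0.
set U := _ %/ _; set V := _ %/ _ => UE VE.
have sU : (size U <= n.+1)%N by rewrite size_divp_XsubC// Ps.
have sV : (size V <= n)%N by rewrite size_divp_XsubC// Ps.
have : L (U * P n) = L (V * P n.+1).
  by rewrite -UE -VE mulrCA mulrA [V * U]mulrC -mulrA.
rewrite (orthogonal_eq_size Lo sU) (orthogonal_lt_size Lo) ?(leq_trans sV)//.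
rewrite coef_divp_XsubC ?Ps//.
have /monicP := Pm n.+1; rewrite /lead_coef Ps /= => ->; rewrite mul1r => h0.
by have := hn0 n; rewrite h0 eqxx.
Qed.

(** The derivative is P_n^2 + 2 (X + z) P_n' P_n. The first term contributes h_n; in the second, (X
    + z) P_n' has coefficient n in degree n, independently of z. *)
Lemma orthogonal_deriv_sqr {R : numFieldType} (L : {scalar {poly R}}) P h n z :
  orthogonal_for L P h ->
  L ((('X + z%:P) * (P n * P n))^`()) = (2 * n + 1)%:R * h n.
Proof.
move=> Lo; have := Lo => -[Pm Ps PP hn0].
have -> : (('X + z%:P) * (P n * P n))^`() =
    P n * P n + (('X + z%:P) * (P n)^`() * P n) *+ 2.
  by rewrite !derivM derivD derivX derivC addr0 mul1r mulr2n; ring.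
rewrite linearD PP eqxx linearMn /= (orthogonal_eq_size Lo); last first.
  by rewrite size_XaddC_mul_leq// size_deriv_leq ?Ps.
rewrite mulrDl coefD coefXM coefCM [X in z * X]nth_default; last first.
  by rewrite size_deriv_leq ?Ps.
have /monicP := Pm n; rewrite /lead_coef Ps /= => P1.
suff -> : (if n == 0 then 0 else (P n)^`()`_n.-1) = n%:R.
  by rewrite natrD natrM -mulr_natl; ring.
by case: n P1 => //= n P1; rewrite coef_deriv P1.
Qed.

(** Only (X + z) P_(n+1)' P_n survives. With p the subleading coefficient of P_(n+1), the factor (X
    + z) P_(n+1)' has coefficients n + 1 and n p + (n + 1) z in degrees n + 1 and n, and n p + (n +
    1) z - (n + 1) p = (n + 1) z - p. *)
Lemma orthogonal_deriv_mixed {R : numFieldType} (L : {scalar {poly R}}) P h n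
    (z : R) :
  orthogonal_for L P h ->
  L ((('X + z%:P) * (P n.+1 * P n))^`()) =
    (n.+1%:R * z - (P n.+1)`_n) * h n.
Proof.
move=> Lo; have := Lo => -[Pm Ps PP hn0].
have -> : (('X + z%:P) * (P n.+1 * P n))^`() =
    P n.+1 * P n + ('X + z%:P) * (P n.+1)^`() * P n
    + ('X + z%:P) * (P n)^`() * P n.+1.
  by rewrite !derivM derivD derivX derivC addr0 mul1r; ring.
rewrite !linearD PP gtn_eqF//= (orthogonal_lt_size Lo (n:=n.+1)); last first.
  by rewrite size_XaddC_mul_leq// size_deriv_leq ?Ps.
rewrite (orthogonal_succ_size Lo) ?size_XaddC_mul_leq ?size_deriv_leq ?Ps//.
rewrite [('X + _) * _]mulrDl !coefD !coefXM !coefCM !coef_deriv /=.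
have /monicP := Pm n.+1; rewrite /lead_coef Ps /= => P1.
rewrite [X in z * (X *+ n.+2)]nth_default ?Ps// P1 mul0rn mulr0 addr0.
suff -> : (if n == 0 then 0 else (P n.+1)`_n.-1.+1 *+ n.-1.+1) = n%:R * (P n.+1)`_n.
  by rewrite -!natr1; ring.
by case: (n) => [|k] /=; rewrite ?mul0r// mulr_natl.
Qed.

(* Differentiates (1 - X^2) Q K = (1 - z^2) Q K - (X + z) Q D, where
   D = (X - z) K. *)
Lemma cd_kernel_deriv {R : numFieldType} (L : {scalar {poly R}}) P h
    (Q : {poly R}) (n : nat) (z : R) :
  orthogonal_for L P h -> (size Q <= n.+2)%N ->
  L (Q * (cd_kernel P h n z)^`()) = 0 ->
  (1 - z ^+ 2) * Q^`().[z] =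
    L (((1 - 'X^2) * (Q * cd_kernel P h n z))^`())
    + L ((('X + z%:P) * (Q * cd_numer P h n z))^`()).
Proof.
move=> Lo sQ; set K := cd_kernel P h n z => QK0.
have -> : (1 - 'X^2) * (Q * K) =
    (1 - z ^+ 2) *: (Q * K) - ('X + z%:P) * (Q * cd_numer P h n z).
  by rewrite -cd_kernelE -/K -mul_polyC rmorphB rmorph1 rmorphXn /=; ring.
rewrite derivB derivZ [L _]linearB [L (_ *: _)]linearZ /= subrK derivM.
rewrite [L _]linearD /= QK0 addr0.
by rewrite (cd_kernel_reproducing _ Lo)// size_deriv_leq.
Qed.

(** * Integration against a step function *)

Lemma integrable_continuous_itv {R : realType} (f : R -> R) (c d : R) :
  {in `[c, d], continuous f} ->
  (@lebesgue_measure R).-integrable `[c, d] (EFin \o f).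
Proof.
move=> cf; apply: continuous_compact_integrable; first exact: segment_compact.
apply: continuous_in_subspaceT => x; rewrite inE /=; exact: cf.
Qed.

Lemma Rintegral_derive1 {R : realType} (F g : R -> R) (c d : R) : c <= d ->
  {in `[c, d], forall x, derivable F x 1} ->
  {in `[c, d], continuous g} -> {in `[c, d], derive1 F =1 g} ->
  \int[lebesgue_measure]_(x in `[c, d]) g x = F d - F c.
Proof.
rewrite le_eqVlt => /predU1P[<-|cd] dF cg Fg.
  by rewrite set_itv1 Rintegral_set1 subrr.
have dF' x : x \in `[c, d] -> {for x, continuous F}.
  move=> /dF dFx; apply: differentiable_continuous.
  by rewrite -derivable1_diffP.
have oc : {subset `]c, d[ <= `[c, d]} by exact: subset_itv_oo_cc.
rewrite /Rintegral (continuous_FTC2 cd (F := F)) ?EFinN//.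
- by apply: continuous_in_subspaceT => x; rewrite inE /=; exact: cg.
- split; first by move=> x /oc; exact: dF.
  + apply: cvg_at_right_filter; apply: dF'.
    by rewrite in_itv /= lexx ltW.
  + apply: cvg_at_left_filter; apply: dF'.
    by rewrite in_itv /= lexx ltW.
- by move=> x /oc; exact: Fg.
Qed.

Lemma measurable_heaviside {R : realType} (s : R) (D : set (measurableTypeR R)) :
  measurable_fun D (fun x : R => heaviside (x - s)).
Proof.
apply: measurable_funTS; apply: measurable_fun_if => //.
apply: measurable_fun_ltr => //.
by apply: measurable_funB.
Qed.

Lemma bounded_heaviside {R : realType} (s : R) (D : set R) :
  [bounded heaviside (x - s) : R^o | x in D].
Proof.
exists 1; split => //= M M1 x _; rewrite /heaviside.
by case: ifP; rewrite ?normr1 ?normr0 ltW// (lt_trans _ M1).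
Qed.

Lemma integrable_heaviside {R : realType} (f : R -> R) (s : R)
    (D : set (measurableTypeR R)) :
  measurable D -> (@lebesgue_measure R).-integrable D (EFin \o f) ->
  (@lebesgue_measure R).-integrable D (EFin \o (fun x => f x * heaviside (x - s))).
Proof.
move=> mD fi.
have := @integrableMl _ (measurableTypeR R) R lebesgue_measure D mD _ _ fi
  (@measurable_heaviside R s D) (@bounded_heaviside R s D).
exact: eq_integrable.
Qed.

(** The maxima treat the three positions of [s] at once: only the part of [c, d] to the right of [s]
    contributes. *)
Lemma Rintegral_heaviside {R : realType} (F g : R -> R) (s c d : R) : c <= d ->
  {in `[c, d], forall x, derivable F x 1} ->
  {in `[c, d], continuous g} -> {in `[c, d], derive1 F =1 g} ->
  \int[lebesgue_measure]_(x in `[c, d]) (g x * heaviside (x - s)) =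
    F (Num.max d s) - F (Num.max c s).
Proof.
move=> cd dF cg Fg; have gi := integrable_continuous_itv cg.
have ghi := integrable_heaviside s (measurable_itv _) gi.
have [ds|sd] := leP d s.
  rewrite (max_r (le_trans cd ds)) subrr.
  under eq_Rintegral => x.
    rewrite inE /= in_itv /= => /andP[_ xd].
    rewrite /heaviside ltNge subr_le0 (le_trans xd ds) /= mulr0. over.
  by rewrite Rintegral_cst// mul0r.
(* The left end is left out because [heaviside (b - s)] is 0 when [b = s]; a single point does not
   change the integral. *)
have right b : c <= b -> s <= b -> b <= d ->
    \int[lebesgue_measure]_(x in `]b, d]) (g x * heaviside (x - s)) = F d - F b.
  move=> cb sb bd.
  have sub : {subset `[b, d] <= `[c, d]}.
    by apply/subset_itvP; apply: subset_itvScc; rewrite bnd_simp.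
  rewrite -(Rintegral_derive1 (F := F) (g := g) bd).
  - under eq_Rintegral => x.
      rewrite inE /= in_itv /= => /andP[bx _].
      rewrite /heaviside subr_gt0 (le_lt_trans sb bx) mulr1. over.
    rewrite Rintegral_itv_obnd_cbnd//.
    apply: integrableS gi => //.
    by apply: subset_itvScc; rewrite bnd_simp.
  - by move=> x /sub; exact: dF.
  - by move=> x /sub; exact: cg.
  - by move=> x /sub; exact: Fg.
have [sc|cs] := leP s c.
  have <- := right c (lexx c) sc cd.
  rewrite Rintegral_itv_obnd_cbnd//.
  apply: integrableS ghi => //.
  by apply: subset_itvScc; rewrite bnd_simp.
have <- := right s (ltW cs) (lexx s) (ltW sd).
rewrite -[RHS](Rintegral_itvB (a := BLeft c)) ?bnd_simp ?ltW//.
rewrite [X in _ = _ - X](_ : _ = 0) ?subr0//.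
under eq_Rintegral => x.
  rewrite inE /= in_itv /= => /andP[_ xs].
  rewrite /heaviside ltNge subr_le0 xs /= mulr0. over.
by rewrite Rintegral_cst// mul0r.
Qed.

Definition jump_step {R : realType} (m : nat) (om t : nat -> R) (x : R) : R :=
  om 0%N + \sum_(1 <= k < m.+1) om k * heaviside (x - t k).

Lemma jump_stepS {R : realType} m (om t : nat -> R) x :
  jump_step m.+1 om t x = jump_step m om t x + om m.+1 * heaviside (x - t m.+1).
Proof. by rewrite /jump_step [in LHS]big_nat_recr//= addrA. Qed.

Lemma integrable_jump_step {R : realType} (f : R -> R) m (om t : nat -> R)
    (D : set (measurableTypeR R)) :
  measurable D -> (@lebesgue_measure R).-integrable D (EFin \o f) ->
  (@lebesgue_measure R).-integrable D
    (EFin \o (fun x => f x * jump_step m om t x)).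
Proof.
move=> mD fi; elim: m => [|m IH].
  have := integrableZr mD (om 0%N) fi; apply: eq_integrable => // x _ /=.
  by rewrite /jump_step big_geq// addr0.
have := integrableD mD IH
  (integrableZr mD (om m.+1) (integrable_heaviside (t m.+1) mD fi)).
apply: eq_integrable => // x _ /=.
by rewrite jump_stepS -EFinM -EFinD; congr EFin; ring.
Qed.

Lemma Rintegral_jump_step {R : realType} (F g : R -> R) m (om t : nat -> R)
    (c d : R) : c <= d ->
  {in `[c, d], forall x, derivable F x 1} ->
  {in `[c, d], continuous g} -> {in `[c, d], derive1 F =1 g} ->
  \int[lebesgue_measure]_(x in `[c, d]) (g x * jump_step m om t x) =
    om 0%N * (F d - F c)
    + \sum_(1 <= k < m.+1) om k * (F (Num.max d (t k)) - F (Num.max c (t k))).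
Proof.
move=> cd dF cg Fg; have gi := integrable_continuous_itv cg.
elim: m => [|m IH].
  rewrite big_geq// addr0 -(Rintegral_derive1 cd dF cg Fg) -RintegralZl//.
  by apply: eq_Rintegral => x _; rewrite /jump_step big_geq// addr0 mulrC.
have gs : (@lebesgue_measure R).-integrable `[c, d]
    (EFin \o (fun x => om m.+1 * (g x * heaviside (x - t m.+1)))).
  have mcd : measurable (`[c, d] : set (measurableTypeR R)) by exact: measurable_itv.
  have := integrableZl mcd (om m.+1) (integrable_heaviside (t m.+1) mcd gi).
  exact: eq_integrable.
rewrite big_nat_recr//= addrA -IH -(Rintegral_heaviside _ cd dF cg Fg).
rewrite -RintegralZl//; last exact: integrable_heaviside.
rewrite -RintegralD//; last exact: integrable_jump_step.
by apply: eq_Rintegral => x _; rewrite jump_stepS; ring.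
Qed.

Lemma within_continuous_oo_cst {R : realType} (f : R -> R) (a b : R) :
  a < b -> {within `[a, b], continuous f} ->
  {in `]a, b[ &, forall x y, f x = f y} -> f a = f b.
Proof.
move=> ab /(continuous_within_itvP _ ab)[_ fa fb] fc.
have c : (a + b) / 2 \in `]a, b[ by rewrite in_itv /=; lra.
transitivity (f ((a + b) / 2)).
  apply: (cvg_unique _ fa) => //; apply: cvg_near_cst.
  near=> x; apply: fc => //; rewrite in_itv /=; apply/andP; split; near: x.
    exact: nbhs_right_gt.
  exact: nbhs_right_lt.
symmetry; apply: (cvg_unique _ fb) => //; apply: cvg_near_cst.
near=> x; apply: fc => //; rewrite in_itv /=; apply/andP; split; near: x.
  exact: nbhs_left_gt.
exact: nbhs_left_lt.
Unshelve. all: by end_near. Qed.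

(** As [s] lies in [a, b], truncation by [s] maps [a, b] into itself, so nothing is asked of [F]
    outside. *)
Lemma within_continuous_maxl {R : realType} (F : R -> R) (a b s : R) : a < b ->
  a <= s <= b -> {within `[a, b], continuous F} ->
  {within `[a, b], continuous (fun x => F (Num.max x s))}.
Proof.
move=> ab /andP[as_ sb] cF.
move/subspace_continuousP: cF => cF.
apply/subspace_continuousP => x /= xab.
have abmax y : y \in `[a, b] -> Num.max y s \in `[a, b].
  by rewrite !in_itv /= ge_max le_max sb => /andP[-> ->].
apply: (@cvg_comp _ _ _ (fun y => Num.max y s) F _
  (within `[a, b] (nbhs (Num.max x s)))); last exact/cF/abmax.
move=> U /= nU.
have cmax : {for x, continuous (fun y : R => Num.max y s)}.
  apply: (max_fun_continuous (f := id) (g := cst s)).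
    by move=> y.
  exact: cst_continuous.
have nU' : nbhs (Num.max x s) (fun y => y \in `[a, b] -> U y) by exact: nU.
suff : nbhs x (fun y => y \in `[a, b] -> U (Num.max y s)) by [].
have : nbhs x (fun y => Num.max y s \in `[a, b] -> U (Num.max y s)).
  exact: (cmax _ nU').
by apply: filterS => y Uy yab; exact/Uy/abmax.
Qed.

Lemma within_continuous_jump_sum {R : realType} (F : R -> R) (a b : R) m
    (om t : nat -> R) : a < b ->
  (forall k, (1 <= k <= m)%N -> a <= t k <= b) ->
  {within `[a, b], continuous F} ->
  {within `[a, b], continuous (fun x => om 0%N * F x
    + \sum_(1 <= k < m.+1) om k * F (Num.max x (t k)))}.
Proof.
move=> ab; elim: m => [|m IH] tab cF.
  rewrite [X in from_subspace _ X](_ : _ = (fun x => om 0%N * F x)); last first.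
    by apply/funext => x; rewrite big_geq// addr0.
  by move=> x; apply: continuousM; [exact: cst_continuous|exact: cF].
rewrite [X in from_subspace _ X](_ : _ = (fun x => om 0%N * F x
    + \sum_(1 <= k < m.+1) om k * F (Num.max x (t k))
    + om m.+1 * F (Num.max x (t m.+1)))); last first.
  by apply/funext => x; rewrite big_nat_recr//= addrA.
move=> x; apply: cvgD.
  by apply: IH => // k /andP[k1 km]; apply: tab; rewrite k1 ltnW.
apply: continuousM; first exact: cst_continuous.
by apply: within_continuous_maxl => //; apply: tab; rewrite /= leqnn.
Qed.

(* Both x |-> int_a^x g S, with S the step function, and
   x |-> om_0 F(x) + sum_k om_k F(max(x, t_k)) are continuous on [a, b] and they
   have the same increments inside ]a, b[. *)
Lemma Rintegral_jump_step_oo {R : realType} (F g : R -> R) m (om t : nat -> R)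
    (a b : R) : a < b ->
  (forall k, (1 <= k <= m)%N -> a <= t k <= b) ->
  {within `[a, b], continuous F} ->
  {in `]a, b[, forall x, derivable F x 1} ->
  {in `]a, b[, continuous g} -> {in `]a, b[, derive1 F =1 g} ->
  (@lebesgue_measure R).-integrable `[a, b]
    (EFin \o (fun x => g x * jump_step m om t x)) ->
  \int[lebesgue_measure]_(x in `[a, b]) (g x * jump_step m om t x) =
    om 0%N * (F b - F a) + \sum_(1 <= k < m.+1) om k * (F b - F (t k)).
Proof.
move=> ab tab cF dF cg Fg gi.
pose I := (parameterized_integral lebesgue_measure a)^~
  (fun x => g x * jump_step m om t x).
pose H x := om 0%N * F x + \sum_(1 <= k < m.+1) om k * F (Num.max x (t k)).
have HB x y : H x - H y = om 0%N * (F x - F y)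
    + \sum_(1 <= k < m.+1) om k * (F (Num.max x (t k)) - F (Num.max y (t k))).
  rewrite /H; under [in RHS]eq_bigr do rewrite mulrBr.
  by rewrite sumrB; ring.
have IH c d : c \in `]a, b[ -> d \in `]a, b[ -> c <= d -> I d - I c = H d - H c.
  rewrite !in_itv /= => /andP[ac cb] /andP[ad db] cd.
  have sub : {subset `[c, d] <= `]a, b[}.
    by apply/subset_itvP; apply: subset_itvSoo; rewrite bnd_simp.
  rewrite HB -(Rintegral_jump_step (g := g) _ _ _ cd).
  - have adi : (@lebesgue_measure R).-integrable `[a, d]
        (EFin \o (fun x => g x * jump_step m om t x)).
      by apply: integrableS gi => //; apply: subset_itvScc; rewrite bnd_simp// ltW.
    rewrite /I /parameterized_integral Rintegral_itvB ?bnd_simp ?(ltW ac)//.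
    rewrite Rintegral_itv_obnd_cbnd//.
    by apply: integrableS adi => //; apply: subset_itvScc; rewrite bnd_simp// ltW.
  - by move=> x /sub; exact: dF.
  - by move=> x /sub; exact: cg.
  - by move=> x /sub; exact: Fg.
have IHab : I a - H a = I b - H b.
  apply: (within_continuous_oo_cst (f := fun x => I x - H x) ab).
    move=> x; apply: continuousB.
      exact: (parameterized_integral_continuous (ltW ab) gi).
    exact: within_continuous_jump_sum.
  move=> x y xab yab; have [xy|/ltW yx] := leP x y.
    by have := IH _ _ xab yab xy; lra.
  by have := IH _ _ yab xab yx; lra.
have Ia : I a = 0.
  by rewrite /I /parameterized_integral set_itv1 Rintegral_set1.
transitivity (H b - H a); first by rewrite -[LHS]/(I b); move: IHab; rewrite Ia; lra.
rewrite HB; congr (_ + _); apply: eq_big_nat => k /tab /andP[ak kb].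
by rewrite (max_l kb) (max_r ak).
Qed.

(** * The Jacobi weight *)

(** Meant for the factor [w0], which is bounded near the endpoints but may have no limit there. *)
Lemma cvg0M_bounded {R : realType} (T : Type) (F : set_system T)
    {FF : ProperFilter F} (f g : T -> R) :
  f x @[x --> F] --> (0 : R) -> bounded_near g F ->
  (f x * g x) @[x --> F] --> (0 : R).
Proof.
move=> /cvgr0Pnorm_lt f0 /ex_bound -[M gM]; apply/cvgr0Pnorm_lt => e e0.
have N0 : 0 < `|M| + 1 by rewrite ltr_wpDl.
near=> x; rewrite normrM.
have gx : `|g x| <= `|M| + 1.
  by rewrite (le_trans (_ : _ <= M)) ?(le_trans (ler_norm M)) ?lerDl//; near: x.
have fx : `|f x| < e / (`|M| + 1) by near: x; apply: f0; rewrite divr_gt0.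
rewrite (le_lt_trans (ler_wpM2l (normr_ge0 _) gx))//.
by rewrite -ltr_pdivlMr.
Unshelve. all: by end_near. Qed.

(** For y > 0 the product is the power of exponent a + 1 > 0. This is where the exponents of the
    weight have to exceed -1. *)
Lemma mulr_powR_cvg0 {R : realType} (a : R) : -1 < a ->
  y * y `^ a @[y --> 0^'+] --> (0 : R).
Proof.
move=> a1; have a10 : 0 < a + 1 by lra.
apply: cvg_trans (powR_cvg0 a10); apply: near_eq_cvg; near=> y.
have y0 : 0 < y by near: y; exact: nbhs_right_gt.
by rewrite powRD ?gt_eqF ?implybT//= powRr1 ?(ltW y0)// mulrC.
Unshelve. all: by end_near. Qed.

(** Transports a limit at 0 from the right to one-sided limits at -1 and 1, through g = 1 + x and g
    = 1 - x. *)
Lemma cvg_comp_within_at_right {R : realType} (f g : R -> R) (x : R)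
    (D : set R) (l : set_system R) :
  (forall y, D y -> 0 < g y) -> {for x, continuous g} -> g x = 0 ->
  f y @[y --> 0^'+] --> l -> f (g y) @[y --> within D (nbhs x)] --> l.
Proof.
move=> gD cg g0 fl A lA.
have fA : nbhs (g x) (fun y => 0 < y -> A (f y)) by rewrite g0; exact: (fl _ lA).
suff : nbhs x (fun y => D y -> A (f (g y))) by [].
have : nbhs x (fun y => 0 < g y -> A (f (g y))) by exact: (cg _ fA).
by apply: filterS => y fgy /gD; exact.
Qed.

Lemma continuous_powR_gt0 {R : realType} (a x : R) : 0 < x ->
  {for x, continuous (fun y : R => y `^ a)}.
Proof.
move=> x0; apply: differentiable_continuous; apply/derivable1_diffP.
by apply: derivable_powR; rewrite in_itv /= x0.
Qed.

Lemma continuous_1B_powR {R : realType} (a x : R) : x < 1 ->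
  {for x, continuous (fun y : R => (1 - y) `^ a)}.
Proof.
move=> x1; apply: (@continuous_comp R R R (fun y => 1 - y) (fun y => y `^ a)).
  by apply: cvgB; [exact: cvg_cst|exact: cvg_id].
by apply: continuous_powR_gt0; lra.
Qed.

Lemma continuous_1D_powR {R : realType} (a x : R) : -1 < x ->
  {for x, continuous (fun y : R => (1 + y) `^ a)}.
Proof.
move=> x1; apply: (@continuous_comp R R R (fun y => 1 + y) (fun y => y `^ a)).
  by apply: cvgD; [exact: cvg_cst|exact: cvg_id].
by apply: continuous_powR_gt0; lra.
Qed.

Lemma continuous_in_oo_eq {R : realType} (f g : R -> R) (a b : R) :
  {in `]a, b[, f =1 g} -> {in `]a, b[, continuous g} -> {in `]a, b[, continuous f}.
Proof.
move=> fg cg x xI; rewrite /continuous_at (fg _ xI); apply: cvg_trans (cg _ xI).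
by apply: near_eq_cvg; near=> y; symmetry; apply: fg; near: y; exact: near_in_itvoo.
Unshelve. all: by end_near. Qed.

Lemma continuous_horner {R : realType} (p : {poly R}) : continuous (horner p).
Proof.
by move=> x; apply: differentiable_continuous; apply/derivable1_diffP.
Qed.

Section JacobiWeight.
Context {R : realType} (al be : R) (w0 : R -> R).
Local Notation w := (jacobi_weight al be w0).
Implicit Types x : R.

Lemma jacobi_weight_gt0 x : smooth_factor w0 -> x \in `]-1, 1[ -> 0 < w x.
Proof.
move=> [_ _ w0_gt0 _ _] xI; have := xI; rewrite in_itv /= => /andP[x1 x2].
rewrite /jacobi_weight !mulr_gt0 ?powR_gt0//; [lra|lra|].
by apply: w0_gt0; exact: subset_itv_oo_cc.
Qed.

Lemma is_derive_jacobi_weight x : smooth_factor w0 -> x \in `]-1, 1[ ->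
  is_derive x 1 w (- al * (1 - x) `^ (al - 1) * (1 + x) `^ be * w0 x
    + (1 - x) `^ al * (be * (1 + x) `^ (be - 1)) * w0 x
    + (1 - x) `^ al * (1 + x) `^ be * derive1 w0 x).
Proof.
move=> [dw0 _ _ _ _] xI; have := xI; rewrite in_itv /= => /andP[x1 x2].
have d1 : is_derive x 1 (fun y : R => (1 - y) `^ al)
    (al * (1 - x) `^ (al - 1) * (0 - 1)).
  apply: (@is_derive1_comp R (fun y => y `^ al) (fun y => 1 - y)).
  by apply: is_derive1_powR; lra.
have d2 : is_derive x 1 (fun y : R => (1 + y) `^ be)
    (be * (1 + x) `^ (be - 1) * (0 + 1)).
  apply: (@is_derive1_comp R (fun y => y `^ be) (fun y => 1 + y)).
  by apply: is_derive1_powR; lra.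
have d3 : is_derive x 1 w0 (derive1 w0 x).
  by rewrite derive1E; apply: DeriveDef => //; exact: dw0.
have d := is_deriveM (is_deriveM d1 d2) d3.
apply: (is_derive_eq d).
by rewrite !fctE /= /GRing.scale /=; ring.
Qed.

(** Logarithmic derivative: v = - ln w gives v' = - w' / w, since w > 0 inside the interval. *)
Lemma derive1_potential x : smooth_factor w0 -> x \in `]-1, 1[ ->
  derive1 w x = - derive1 (potential w) x * w x.
Proof.
move=> sw xI; have w_gt0 := jacobi_weight_gt0 sw xI.
have [dw _] := is_derive_jacobi_weight sw xI.
have dw' : is_derive x 1 w (derive1 w x) by rewrite derive1E; exact: DeriveDef.
have dl := is_derive1_comp (is_derive1_ln w_gt0) dw'.
have -> : potential w = - (@ln R \o w) by apply/funext.
rewrite [derive1 (- _) _]derive1E derive_val opprK.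
by rewrite mulrAC mulVf ?mul1r// gt_eqF.
Qed.

Lemma derive1_jacobi_weight_continuous : smooth_factor w0 ->
  {in `]-1, 1[, continuous (derive1 w)}.
Proof.
move=> sw; apply: continuous_in_oo_eq => x xI.
  by rewrite derive1E; have [_ ->] := is_derive_jacobi_weight sw xI.
have := xI; rewrite in_itv /= => /andP[x1 x2].
have cl a := @continuous_1B_powR _ a _ x2.
have cr a := @continuous_1D_powR _ a _ x1.
have [dw0 cw0' _ _ _] := sw.
have cw0 : {for x, continuous w0}.
  by apply: differentiable_continuous; apply/derivable1_diffP; exact: dw0.
apply: cvgD; first apply: cvgD.
- apply: cvgM; last exact: cw0.
  by apply: cvgM; [apply: cvgM; [exact: cvg_cst|exact: cl]|exact: cr].
- apply: cvgM; last exact: cw0.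
  by apply: cvgM; [exact: cl|apply: cvgM; [exact: cvg_cst|exact: cr]].
- by apply: cvgM; [apply: cvgM; [exact: cl|exact: cr]|exact: cw0'].
Qed.

(* As al, be > -1, the factor 1 - x^2 makes up for the singularities of w. *)
Lemma within_continuous_jacobi_weight (p : {poly R}) : -1 < al -> -1 < be ->
  smooth_factor w0 ->
  {within `[-1, 1], continuous (fun x => ((1 - 'X^2) * p).[x] * w x)}.
Proof.
move=> al1 be1 sw; have N11 : -1 < 1 :> R by lra.
have [_ _ _ bl br] := sw.
have hE x : ((1 - 'X^2) * p).[x] = (1 - x ^+ 2) * p.[x] by rewrite !hornerE.
apply/(continuous_within_itvP _ N11); split => [x xI||].
- apply: cvgM; first exact: continuous_horner.
  have [dw _] := is_derive_jacobi_weight sw xI.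
  by apply: differentiable_continuous; apply/derivable1_diffP.
- rewrite [X in _ --> X](_ : _ = 0); last by rewrite hE; ring.
  (* Three kinds of factors at -1: (1 + x)^(be + 1) tends to 0, the others here are continuous, and
     [w0], put back afterwards, is bounded. The endpoint 1 is symmetric. *)
  have lim0 : (1 + x) * (1 + x) `^ be * ((1 - x) * p.[x] * (1 - x) `^ al)
      @[x --> (-1)^'+] --> (0 : R).
    rewrite -[X in _ --> X](mul0r ((1 - -1) * p.[-1] * (1 - -1) `^ al)).
    apply: cvgM.
      apply: (@cvg_comp_within_at_right _ (fun y => y * y `^ be) (fun x => 1 + x)).
      + by move=> y /=; lra.
      + by apply: cvgD; [exact: cvg_cst|exact: cvg_id].
      + by rewrite addrN.
      + exact: mulr_powR_cvg0.
    apply: cvg_at_right_filter; apply: cvgM; first apply: cvgM.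
    + by apply: cvgB; [exact: cvg_cst|exact: cvg_id].
    + exact: continuous_horner.
    + by apply: continuous_1B_powR; lra.
  apply: cvg_trans (cvg0M_bounded lim0 bl); apply: near_eq_cvg; near=> x.
  by rewrite /jacobi_weight hE; ring.
- rewrite [X in _ --> X](_ : _ = 0); last by rewrite hE; ring.
  have lim0 : (1 - x) * (1 - x) `^ al * ((1 + x) * p.[x] * (1 + x) `^ be)
      @[x --> 1^'-] --> (0 : R).
    rewrite -[X in _ --> X](mul0r ((1 + 1) * p.[1] * (1 + 1) `^ be)).
    apply: cvgM.
      apply: (@cvg_comp_within_at_right _ (fun y => y * y `^ al) (fun x => 1 - x)).
      + by move=> y /=; lra.
      + by apply: cvgB; [exact: cvg_cst|exact: cvg_id].
      + by rewrite subrr.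
      + exact: mulr_powR_cvg0.
    apply: cvg_at_left_filter; apply: cvgM; first apply: cvgM.
    + by apply: cvgD; [exact: cvg_cst|exact: cvg_id].
    + exact: continuous_horner.
    + by apply: continuous_1D_powR; lra.
  apply: cvg_trans (cvg0M_bounded lim0 br); apply: near_eq_cvg; near=> x.
  by rewrite /jacobi_weight hE; ring.
Unshelve. all: by end_near. Qed.

End JacobiWeight.

(** * The ladder operators *)

Lemma integrable_poly_jump_weight {R : realType} m (om t : nat -> R)
    (w : R -> R) (p : {poly R}) : finite_moments w ->
  (@lebesgue_measure R).-integrable `[-1, 1]
    (fun x => (p.[x] * jump_weight w m om t x)%:E).
Proof.
move=> fm.
have mI : measurable (`[-1, 1] : set (measurableTypeR R)) by exact: measurable_itv.
have pw : (@lebesgue_measure R).-integrable `[-1, 1]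
    (EFin \o (fun x => p.[x] * w x)).
  have := @integrable_sum _ (measurableTypeR R) R lebesgue_measure _ mI _
    (index_enum 'I_(size p)) xpredT _ (fun i _ => integrableZl mI p`_i (fm i)).
  apply: eq_integrable => // x _ /=; rewrite horner_coef mulr_suml -sumEFin.
  by apply: eq_bigr => i _; rewrite -EFinM mulrA.
have := integrable_jump_step m om t mI pw; apply: eq_integrable => // x _ /=.
by rewrite mulrA.
Qed.

(** Finite moments make every polynomial integrable against the jump weight, so the integral is
    linear on all polynomials and can be bundled as a functional. *)
Lemma jump_weight_functional {R : realType} m (om t : nat -> R) (w : R -> R) :
  finite_moments w ->
  exists L : {scalar {poly R}}, forall p,
    L p = \int[lebesgue_measure]_(x in `[-1, 1]) (p.[x] * jump_weight w m om t x).
Proof.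
move=> fm; pose l (p : {poly R}) :=
  \int[lebesgue_measure]_(x in `[-1, 1]) (p.[x] * jump_weight w m om t x).
have lin : scalar l.
  move=> a p q /=; rewrite /l -RintegralZl//; last first.
    exact: integrable_poly_jump_weight.
  rewrite -RintegralD//; last exact: integrable_poly_jump_weight.
    by apply: eq_Rintegral => x _; rewrite hornerD hornerZ; ring.
  have mI : measurable (`[-1, 1] : set (measurableTypeR R)) by exact: measurable_itv.
  have := integrableZl mI a (integrable_poly_jump_weight m om t p fm).
  exact: eq_integrable.
pose lM := GRing.isLinear.Build _ _ _ _ l lin.
pose L : {scalar {poly R}} := HB.pack l lM.
by exists L.
Qed.

(** The primitive F = (1 - x^2) p w vanishes at both endpoints, so integrating F' against the step
    function leaves only - om_k F(t_k) for each jump. *)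
Lemma jump_integration_by_parts {R : realType} (al be : R) (w0 : R -> R) m
    (om t : nat -> R) (p : {poly R}) :
  let w := jacobi_weight al be w0 in
  -1 < al -> -1 < be -> smooth_factor w0 -> finite_moments w ->
  (forall k, (1 <= k <= m)%N -> -1 <= t k <= 1) ->
  (@lebesgue_measure R).-integrable `[-1, 1]
    (fun x => ((1 - x ^+ 2) * derive1 (potential w) x * p.[x]
      * jump_weight w m om t x)%:E) ->
  \int[lebesgue_measure]_(x in `[-1, 1])
      (((1 - 'X^2) * p)^`().[x] * jump_weight w m om t x) =
    \int[lebesgue_measure]_(x in `[-1, 1])
      ((1 - x ^+ 2) * derive1 (potential w) x * p.[x] * jump_weight w m om t x)
    - \sum_(1 <= k < m.+1) om k * ((1 - t k ^+ 2) * p.[t k] * w (t k)).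
Proof.
move=> w al1 be1 sw fm tI pi; have N11 : -1 < 1 :> R by lra.
have hE (x : R) : ((1 - 'X^2) * p).[x] = (1 - x ^+ 2) * p.[x] by rewrite !hornerE.
pose F x := ((1 - 'X^2) * p).[x] * w x.
(* [g] is F' with w' replaced by - v' w; the two terms are integrated separately at the end. *)
pose g x := ((1 - 'X^2) * p)^`().[x] * w x
            - (1 - x ^+ 2) * derive1 (potential w) x * p.[x] * w x.
have mI : measurable (`[-1, 1] : set (measurableTypeR R)) by exact: measurable_itv.
have dF (x : R) : x \in `]-1, 1[ -> is_derive x 1 F (g x).
  move=> xI; have [dw _] := is_derive_jacobi_weight al be sw xI.
  have dw' : is_derive x 1 w (- derive1 (potential w) x * w x).
    by rewrite -derive1_potential// derive1E; exact: DeriveDef.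
  have dp : is_derive x (1 : R) (horner ((1 - 'X^2) * p)) ((1 - 'X^2) * p)^`().[x].
    exact: is_derive_poly.
  apply: is_derive_eq (is_deriveM dp dw') _.
  by rewrite /g /GRing.scale /= hE; ring.
have gi : (@lebesgue_measure R).-integrable `[-1, 1]
    (EFin \o (fun x => g x * jump_step m om t x)).
  have := integrableB mI
    (integrable_poly_jump_weight m om t ((1 - 'X^2) * p)^`() fm) pi.
  apply: eq_integrable => // x _ /=.
  by rewrite -EFinB /g /jump_weight -/(jump_step m om t x); congr EFin; ring.
have cg : {in `]-1, 1[, continuous g}.
  apply: (@continuous_in_oo_eq _ _
    (fun x => ((1 - 'X^2) * p)^`().[x] * w x + ((1 - 'X^2) * p).[x] * derive1 w x)).
    by move=> x xI; rewrite derive1_potential// -/w /g hE; ring.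
  move=> x xI; have [dw _] := is_derive_jacobi_weight al be sw xI.
  apply: cvgD; apply: cvgM; try exact: continuous_horner.
    by apply: differentiable_continuous; apply/derivable1_diffP.
  exact: (derive1_jacobi_weight_continuous sw).
have H := @Rintegral_jump_step_oo _ F g m om t _ _ N11 tI
  (@within_continuous_jacobi_weight _ _ _ _ p al1 be1 sw) _ cg _ gi.
have F1 : F 1 = 0 by rewrite /F hE; ring.
have FN1 : F (-1) = 0 by rewrite /F hE; ring.
transitivity (\int[lebesgue_measure]_(x in `[-1, 1]) (g x * jump_step m om t x)
    + \int[lebesgue_measure]_(x in `[-1, 1])
        ((1 - x ^+ 2) * derive1 (potential w) x * p.[x] * jump_weight w m om t x)).
  rewrite -RintegralD//; apply: eq_Rintegral => x _.
  by rewrite /g /jump_weight -/(jump_step m om t x); ring.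
rewrite addrC H; last 2 first.
- by move=> x /dF[].
- by move=> x /dF[d <-]; rewrite derive1E.
rewrite F1 FN1 subr0 mulr0 add0r -sumrN; congr (_ + _).
by apply: eq_bigr => k _; rewrite /F hE; ring.
Qed.

(* The value of [ladder_form] at p = P_i P_j collects the three contributions
   to (1 - z^2) A_n (i = j = n) and to (1 - z^2) B_n (i = n, j = n - 1), up to
   normalization. *)
Definition ladder_form {R : realType} (w : R -> R) (m : nat) (om t : nat -> R)
    (z : R) (p : {poly R}) : R :=
  \int[lebesgue_measure]_(x in `[-1, 1])
    ((('X + z%:P) * p)^`().[x] * jump_weight w m om t x)
  + \int[lebesgue_measure]_(x in `[-1, 1])
    (potential_quotient w z x * p.[x] * jump_weight w m om t x)
  + \sum_(1 <= k < m.+1)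
      om k * w (t k) * p.[t k] * ((1 - t k ^+ 2) / (z - t k)).

(** The common form of [ladder_A_exists] (p = P_n P_n) and, for n > 0, [ladder_B_exists] (p = P_n
    P_(n-1)). *)
Definition quotient_integrable {R : realType} (w : R -> R) (m : nat)
    (om t : nat -> R) (z : R) (p : {poly R}) : Prop :=
  (@lebesgue_measure R).-integrable `[-1, 1]
    (fun x => (potential_quotient w z x * p.[x] * jump_weight w m om t x)%:E).

Lemma quotient_integrableB {R : realType} (w : R -> R) m om t z (a b : R) p q :
  quotient_integrable w m om t z p -> quotient_integrable w m om t z q ->
  quotient_integrable w m om t z (a *: p - b *: q).
Proof.
move=> ip iq.
have mI : measurable (`[-1, 1] : set (measurableTypeR R)) by exact: measurable_itv.
have := integrableB mI (integrableZl mI a ip) (integrableZl mI b iq).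
apply: eq_integrable => // x _ /=.
by rewrite -!EFinM -EFinB hornerD hornerN !hornerZ; congr EFin; ring.
Qed.

Lemma ladder_formB {R : realType} (w : R -> R) m om t z (a b : R) p q :
  finite_moments w ->
  quotient_integrable w m om t z p -> quotient_integrable w m om t z q ->
  ladder_form w m om t z (a *: p - b *: q) =
  a * ladder_form w m om t z p - b * ladder_form w m om t z q.
Proof.
move=> fm ip iq.
have mI : measurable (`[-1, 1] : set (measurableTypeR R)) by exact: measurable_itv.
have [L LE] := jump_weight_functional m om t fm.
rewrite /ladder_form -!LE.
have -> : ('X + z%:P) * (a *: p - b *: q) =
    a *: (('X + z%:P) * p) - b *: (('X + z%:P) * q).
  by rewrite -!mul_polyC; ring.
rewrite derivB !derivZ [L _]linearB [L (a *: _)]linearZ [L (b *: _)]linearZ /=.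
have -> : \int[lebesgue_measure]_(x in `[-1, 1])
    (potential_quotient w z x * (a *: p - b *: q).[x] * jump_weight w m om t x) =
    a * \int[lebesgue_measure]_(x in `[-1, 1])
      (potential_quotient w z x * p.[x] * jump_weight w m om t x)
    - b * \int[lebesgue_measure]_(x in `[-1, 1])
      (potential_quotient w z x * q.[x] * jump_weight w m om t x).
  rewrite -RintegralZl// -RintegralZl// -RintegralB//.
  - by apply: eq_Rintegral => x _; rewrite hornerD hornerN !hornerZ; ring.
  - by have := integrableZl mI a ip; exact: eq_integrable.
  - by have := integrableZl mI b iq; exact: eq_integrable.
have -> : \sum_(1 <= k < m.+1) om k * w (t k) * (a *: p - b *: q).[t k]
      * ((1 - t k ^+ 2) / (z - t k)) =
    a * \sum_(1 <= k < m.+1) om k * w (t k) * p.[t k]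
      * ((1 - t k ^+ 2) / (z - t k))
    - b * \sum_(1 <= k < m.+1) om k * w (t k) * q.[t k]
      * ((1 - t k ^+ 2) / (z - t k)).
  rewrite !mulr_sumr -sumrB; apply: eq_bigr => k _.
  by rewrite hornerD hornerN !hornerZ; ring.
ring.
Qed.

Lemma sum_partial_fractions {R : realType} (m : nat) (t f : nat -> R) (z : R) :
  (forall k, (1 <= k <= m)%N -> z != t k) ->
  \sum_(1 <= k < m.+1) f k * ((1 - t k ^+ 2) / (z - t k)) =
  \sum_(1 <= k < m.+1) f k * (z + t k)
  + (1 - z ^+ 2) * \sum_(1 <= k < m.+1) f k / (z - t k).
Proof.
move=> zt; rewrite mulr_sumr -big_split; apply: eq_big_nat => k /zt ztk /=.
by field; rewrite subr_eq0.
Qed.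

Lemma orthogonal_for_jump_weight {R : realType} (w : R -> R) m om t P h
    (L : {scalar {poly R}}) :
  (forall p, L p = \int[lebesgue_measure]_(x in `[-1, 1])
    (p.[x] * jump_weight w m om t x)) ->
  monic_orthogonal (jump_weight w m om t) P h -> orthogonal_for L P h.
Proof.
move=> LE [Pm Ps PP h0]; split => // i j; rewrite LE -PP.
by apply: eq_Rintegral => x _; rewrite hornerM.
Qed.

Lemma ladder_A_form {R : realType} (w : R -> R) m om t P h n z :
  finite_moments w -> monic_orthogonal (jump_weight w m om t) P h ->
  (forall k, (1 <= k <= m)%N -> z != t k) -> 1 - z ^+ 2 != 0 ->
  h n * ((1 - z ^+ 2) * ladder_A w m om t P h n z) =
  ladder_form w m om t z (P n * P n).
Proof.
move=> fm mo zt z1; have [L LE] := jump_weight_functional m om t fm.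
have Lo := orthogonal_for_jump_weight LE mo; have hn := orthogonal_for_neq0 Lo n.
rewrite /ladder_form -LE (orthogonal_deriv_sqr _ _ Lo) /ladder_A.
rewrite mulrDr mulrA divff// mul1r.
rewrite -[X in h n * X]addrA -sum_partial_fractions//.
rewrite mulrDr mulrDr mulrA divff// mul1r mulr_sumr.
rewrite [X in X + _ + _](_ : _ = \int[lebesgue_measure]_(x in `[-1, 1])
    (potential_quotient w z x * (P n * P n).[x] * jump_weight w m om t x)).
  rewrite [X in X + _]addrC [h n * _]mulrC; congr (_ + _).
  apply: eq_bigr => k _; rewrite /ladder_R hornerM.
  by move: (_ / (z - _)) => u; field.
by apply: eq_Rintegral => x _; rewrite /integrand_A hornerM; ring.
Qed.

(** B_(n+1) is normalized by h_n, hence the shifted index. The polynomial part comes from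
    [orthogonal_deriv_mixed], the jump terms from partial fractions. *)
Lemma ladder_B_form {R : realType} (w : R -> R) m om t P h n z :
  finite_moments w -> monic_orthogonal (jump_weight w m om t) P h ->
  (forall k, (1 <= k <= m)%N -> z != t k) -> 1 - z ^+ 2 != 0 ->
  h n * ((1 - z ^+ 2) * ladder_B w m om t P h n.+1 z) =
  ladder_form w m om t z (P n.+1 * P n).
Proof.
move=> fm mo zt z1; have [L LE] := jump_weight_functional m om t fm.
have Lo := orthogonal_for_jump_weight LE mo; have hn := orthogonal_for_neq0 Lo n.
rewrite /ladder_form -LE (orthogonal_deriv_mixed _ _ Lo) /ladder_B.
rewrite mulrDr mulrA divff// mul1r.
rewrite -[X in h n * X]addrA -sum_partial_fractions//.
rewrite -[X in h n * (X + _)]addrA.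
rewrite mulrDr mulrDr mulrA divff// mul1r mulr_sumr.
rewrite [X in X + _ + _](_ : _ = \int[lebesgue_measure]_(x in `[-1, 1])
    (potential_quotient w z x * (P n.+1 * P n).[x] * jump_weight w m om t x)).
  rewrite [X in X + _]addrC [h n * (_ - _)]mulrC; congr (_ + _).
  apply: eq_bigr => k _; rewrite /ladder_r hornerM /=.
  by move: (_ / (z - _)) => u; field.
by apply: eq_Rintegral => x _; rewrite /integrand_B hornerM; ring.
Qed.

Lemma potential_quotientE {R : realType} (w : R -> R) (z x : R) :
  (1 - x ^+ 2) * derive1 (potential w) x =
  (1 - z ^+ 2) * derive1 (potential w) z + potential_quotient w z x * (x - z).
Proof.
(* At x = z the quotient is a division by 0, but it is multiplied by x - z = 0. *)
have [->|xz] := eqVneq x z; first by rewrite subrr mulr0 addr0.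
by rewrite /potential_quotient; field; rewrite subr_eq0 eq_sym.
Qed.

(** Common source of both ladder relations, through Q = P_(n+1) and Q = P_n. The value of L (Q K), 0
    or Q(z), decides whether a term in v' appears. *)
Lemma ladder_identity {R : realType} (al be : R) (w0 : R -> R) m
    (om t : nat -> R) P h
    (L : {scalar {poly R}}) (Q : {poly R}) n (z : R) :
  let w := jacobi_weight al be w0 in
  -1 < al -> -1 < be -> smooth_factor w0 -> finite_moments w ->
  (forall k, (1 <= k <= m)%N -> -1 <= t k <= 1) ->
  (forall p, L p = \int[lebesgue_measure]_(x in `[-1, 1])
    (p.[x] * jump_weight w m om t x)) ->
  orthogonal_for L P h ->
  (forall k, (1 <= k <= m)%N -> z != t k) ->
  (size Q <= n.+2)%N -> L (Q * (cd_kernel P h n z)^`()) = 0 ->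
  quotient_integrable w m om t z (Q * P n.+1) ->
  quotient_integrable w m om t z (Q * P n) ->
  (1 - z ^+ 2) * Q^`().[z] =
    (h n)^-1 * ((P n).[z] * ladder_form w m om t z (Q * P n.+1)
                - (P n.+1).[z] * ladder_form w m om t z (Q * P n))
    + (1 - z ^+ 2) * derive1 (potential w) z * L (Q * cd_kernel P h n z).
Proof.
move=> w al1 be1 sw fm tI LE Lo zt sQ QK0 i1 i0.
set K := cd_kernel P h n z; set D := cd_numer P h n z.
have KD x : K.[x] * (x - z) = D.[x] by rewrite /D -cd_kernelE hornerM hornerXsubC.
have mI : measurable (`[-1, 1] : set (measurableTypeR R)) by exact: measurable_itv.
have QD : Q * D = ((h n)^-1 * (P n).[z]) *: (Q * P n.+1)
    - ((h n)^-1 * (P n.+1).[z]) *: (Q * P n).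
  by rewrite /D /cd_numer -!mul_polyC !rmorphM /=; ring.
have iQD : quotient_integrable w m om t z (Q * D).
  by rewrite QD; exact: quotient_integrableB.
have iQK := integrable_poly_jump_weight m om t (Q * K) fm.
set c := (1 - z ^+ 2) * derive1 (potential w) z.
have icQK : lebesgue_measure.-integrable `[-1, 1]
    (EFin \o (fun x => c * ((Q * K).[x] * jump_weight w m om t x))).
  by have := integrableZl mI c iQK; exact: eq_integrable.
have split x : (1 - x ^+ 2) * derive1 (potential w) x * (Q * K).[x]
      * jump_weight w m om t x =
    c * ((Q * K).[x] * jump_weight w m om t x)
    + potential_quotient w z x * (Q * D).[x] * jump_weight w m om t x.
  by rewrite (potential_quotientE w z) -/c !hornerM -KD; ring.
(* The integrability required for integration by parts follows from that of the two summands in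
   [split]. *)
have iV : lebesgue_measure.-integrable `[-1, 1] (fun x =>
    ((1 - x ^+ 2) * derive1 (potential w) x * (Q * K).[x]
      * jump_weight w m om t x)%:E).
  have := integrableD mI icQK iQD; apply: eq_integrable => // x _ /=.
  by rewrite split EFinD.
have ibp := jump_integration_by_parts al1 be1 sw fm tI iV.
rewrite (cd_kernel_deriv Lo sQ QK0) -/K -/D.
transitivity (ladder_form w m om t z (Q * D) + c * L (Q * K)); last first.
  by rewrite QD ladder_formB//; ring.
rewrite /ladder_form [L (((1 - _) * _)^`())]LE ibp -LE.
under [\int[_]_(x in _) ((1 - _) * _ * _ * _)]eq_Rintegral => x _ do rewrite split.
rewrite RintegralD// RintegralZl// -LE.
(* The sign comes from K(t_k) = D(t_k) / (t_k - z), while the form divides by z - t_k. *)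
suff -> : \sum_(1 <= k < m.+1) om k * ((1 - t k ^+ 2) * (Q * K).[t k] * w (t k)) =
    - \sum_(1 <= k < m.+1) om k * w (t k) * (Q * D).[t k]
      * ((1 - t k ^+ 2) / (z - t k)) by ring.
rewrite -sumrN; apply: eq_big_nat => k /zt ztk.
by rewrite !hornerM -KD; field; rewrite subr_eq0.
Qed.

Unset Implicit Arguments.

Theorem theorem4p4 (R : realType) (alpha beta : R) (w0 : R -> R)
    (m : nat) (omega t : nat -> R) (P : nat -> {poly R}) (h : nat -> R) :
  let wJ := jacobi_weight alpha beta w0 in
  let vJ := potential wJ in
  let Pprev := pred_term (0 : {poly R}) P in
  let A := ladder_A wJ m omega t P h in
  let B := ladder_B wJ m omega t P h in
  let A_exists := ladder_A_exists wJ m omega t P in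
  let B_exists := ladder_B_exists wJ m omega t P in
  -1 < alpha -> -1 < beta ->
  smooth_factor w0 ->
  finite_moments wJ ->
  (forall k, (1 <= k <= m)%N -> -1 <= t k <= 1) ->
  (forall j k, (1 <= j)%N -> (j < k)%N -> (k <= m)%N -> t j < t k) ->
  (forall l, (l <= m)%N -> 0 <= \sum_(0 <= k < l.+1) omega k) ->
  monic_orthogonal (jump_weight wJ m omega t) P h ->
  forall (n : nat) (z : R),
    -1 < z < 1 ->
    (forall k, (1 <= k <= m)%N -> z != t k) ->
    (A_exists z n -> B_exists z n ->
       (deriv (P n)).[z] =
         - B n z * (P n).[z] + rec_beta h n * A n z * (Pprev n).[z])
    /\
    (B_exists z n -> pred_term True (A_exists z) n ->
       (deriv (Pprev n)).[z] =
         (B n z + derive1 vJ z) * (Pprev n).[z]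
         - pred_term (fun _ => 0) A n z * (P n).[z]).
Proof.
move=> wJ vJ Pprev A B A_exists B_exists al1 be1 sw fm tI _ _ mo n z z11 zt.
have z1 : 1 - z ^+ 2 != 0.
  have -> : 1 - z ^+ 2 = (1 - z) * (1 + z) by ring.
  by case/andP: z11 => ? ?; rewrite mulf_neq0 ?gt_eqF//; lra.
have [L LE] := jump_weight_functional m omega t fm.
have Lo := orthogonal_for_jump_weight LE mo; have [_ Ps PP h0] := Lo.
(* For n = 0 all terms vanish, as P_0 = 1, P_(-1) = 0, B_0 = 0 and A_(-1) = 0. Otherwise the index
   is n + 1 and the kernel is normalized by h_n. *)
case: n => [|n].
  have /monicP := orthogonal_for_monic Lo 0%N; rewrite /lead_coef Ps /= => P0.
  have -> : P 0%N = 1.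
    by apply/polyP => i; case: i => [|i]; rewrite coef1 ?P0// nth_default ?Ps.
  by rewrite /= !derivC !hornerE; split=> _ _; rewrite ?deriv0 ?horner0 /B /= oppr0.
have iA k : A_exists z k -> quotient_integrable wJ m omega t z (P k * P k).
  by apply: eq_integrable => // x _; rewrite /integrand_A hornerM mulrA expr2 mulrA.
have iB : B_exists z n.+1 -> quotient_integrable wJ m omega t z (P n.+1 * P n).
  move=> /(_ isT); apply: eq_integrable => // x _.
  by rewrite /integrand_B hornerM [_ * (_.[x] * _.[x])]mulrA.
(* K' has degree below n, so it is orthogonal to both P_n and P_(n+1), as [ladder_identity]
   requires. *)
have sK' : (size (cd_kernel P h n z)^`() <= n)%N.
  by rewrite size_deriv_leq// (size_cd_kernel _ _ Lo).
have ident Q := @ladder_identity _ _ _ _ _ _ _ _ _ _ Q n z al1 be1 sw fm tI LE Lo zt.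
have Amul k := ladder_A_form k fm mo zt z1.
have Bmul := ladder_B_form n fm mo zt z1.
split=> [/iA iAn /iB iBn | /iB iBn /iA iAn]; apply: (mulfI z1).
(* Q = P_(n+1): L (Q K) = 0 since K has degree at most n. The forms yield A_(n+1) and B_(n+1), and
   h_(n+1) / h_n is beta_(n+1). *)
- rewrite ident ?Ps//; last first.
    by rewrite mulrC (orthogonal_lt_size Lo)// (leq_trans sK').
  rewrite [P n.+1 * cd_kernel _ _ _ _]mulrC (orthogonal_lt_size Lo); last first.
    exact: size_cd_kernel Lo.
  rewrite -Amul -Bmul /A /B /Pprev /=; have := h0 n => hn.
  by field; rewrite hn z1.
(* Q = P_n: the reproducing property gives L (Q K) = P_n(z), which is the v' term; the forms yield
   B_(n+1) and A_n. *)
- rewrite /Pprev /= ident ?Ps//; last 2 first.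
  + by rewrite mulrC (orthogonal_lt_size Lo).
  + by rewrite mulrC.
  rewrite (cd_kernel_reproducing _ Lo) ?Ps//.
  rewrite -Amul [P n * P n.+1]mulrC -Bmul /A /B /Pprev /= /vJ; have := h0 n => hn.
  by field; rewrite hn z1.
Qed.
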